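(* Let $A\in\mathbb{R}^{n\times n}$ and $b\in\mathbb{R}^n$, and let $\ell$ be the maximal dimension of the Krylov subspaces $\mathcal{K}_k(A,b)$, $k\ge0$. Take the initial approximation $x_0=0$. If $A^\top=A$ and $b\notin\mathrm{range}(A)$, then the $(\ell-1)$th MINARES iterate $$x_{\ell-1}^{\mathrm A}=\operatorname*{argmin}_{x\in\mathcal{K}_{\ell-1}(A,b)}\|A(b-Ax)\|$$ is equal to the $(\ell-1)$th MINRES iterate $$x_{\ell-1}=\operatorname*{argmin}_{x\in\mathcal{K}_{\ell-1}(A,b)}\|b-Ax\|.$$
   Context: For a matrix $A\in\mathbb{R}^{n\times n}$ and a vector $v\in\mathbb{R}^n$, the $k$th Krylov subspace is $\mathcal{K}_k(A,v)=\mathrm{span}\{v,Av,\ldots,A^{k-1}v\}$, with $\mathcal{K}_0(A,v)=\{0\}$. The integer $\ell$ is characterized by $\dim\mathcal{K}_k(A,b)=k$ for $k\le\ell$ and $\dim\mathcal{K}_k(A,b)=\ell$ for $k\ge\ell+1$. $\|\cdot\|$ is the Euclidean norm. Under the stated hypotheses both minimizers are unique. *)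

(* Defs.v *)
From mathcomp Require Import all_boot all_order all_algebra.
From mathcomp Require Import reals.

Set Implicit Arguments.
Unset Strict Implicit.
Unset Printing Implicit Defensive.

Import Order.TTheory GRing.Theory Num.Theory.
Local Open Scope ring_scope.

(* Not the norm `|v| that MathComp-Analysis puts on matrices, which is the
   maximum norm. *)
Definition norm2 (R : realType) (n : nat) (v : 'cV[R]_n) : R :=
  Num.sqrt (\sum_i v i 0 ^+ 2).

Definition krylov (R : realType) (n : nat) (A : 'M[R]_n) (v : 'cV[R]_n)
    (k : nat) : {vspace 'cV[R]_n} :=
  <<[seq A ^+ i *m v | i <- iota 0 k]>>%VS.

Definition krylov_max_dim (R : realType) (n : nat) (A : 'M[R]_n)
    (b : 'cV[R]_n) (l : nat) : Prop :=
  (exists k, \dim (krylov A b k) = l) /\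
  (forall k, (\dim (krylov A b k) <= l)%N).

Definition is_argmin (R : realType) (V : vectType R) (S : {vspace V})
    (f : V -> R) (x : V) : Prop :=
  x \in S /\ forall y, y \in S -> f x <= f y.

(* Both iterates are taken from the initial approximation 0, so that the
   initial residual is b and the search space is krylov A b k itself. *)
Definition is_minres_iterate (R : realType) (n : nat) (A : 'M[R]_n)
    (b : 'cV[R]_n) (k : nat) (x : 'cV[R]_n) : Prop :=
  is_argmin (krylov A b k) (fun y => norm2 (b - A *m y)) x.

Definition is_minares_iterate (R : realType) (n : nat) (A : 'M[R]_n)
    (b : 'cV[R]_n) (k : nat) (x : 'cV[R]_n) : Prop :=
  is_argmin (krylov A b k) (fun y => norm2 (A *m (b - A *m y))) x.

(* Main.v *)
(* With K the (l-1)-st Krylov space, there is x in K with A (b - A x) = 0. Such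
   an x minimizes |A (b - A y)|, as the value is 0; it also minimizes
   |b - A y|, because for symmetric A the residual b - A x is orthogonal to the
   range of A. Both minimizers are unique because A is injective on K and A^2
   has the same kernel as A. *)
Require Import Defs.
From mathcomp Require Import all_boot all_order all_algebra.
From mathcomp Require Import reals.

Set Implicit Arguments.
Unset Strict Implicit.
Unset Printing Implicit Defensive.

Import Order.TTheory GRing.Theory Num.Theory.
Local Open Scope ring_scope.

Lemma poly_MXaddC (R : nzRingType) (p : {poly R}) :
  exists q c, p = q * 'X + c%:P.
Proof.
elim/poly_ind: p => [|q c _]; last by exists q, c.
by exists 0, 0; rewrite mul0r add0r.
Qed.

Section SymmetricLeastSquares.
Variables (R : realType) (n : nat).
Implicit Types u v w x y : 'cV[R]_n.

Lemma norm2_sq v : norm2 v ^+ 2 = (v^T *m v) 0 0.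
Proof.
rewrite sqr_sqrtr ?sumr_ge0 // => [|i _]; last exact: sqr_ge0.
by rewrite mxE; apply: eq_bigr => i _; rewrite mxE expr2.
Qed.

Lemma norm2_ge0 v : 0 <= norm2 v.
Proof. exact: sqrtr_ge0. Qed.

Lemma norm2_eq0 v : (norm2 v == 0) = (v == 0).
Proof.
apply/idP/eqP => [|->]; last first.
  by rewrite -sqrf_eq0 norm2_sq mulmx0 mxE.
rewrite sqrtr_eq0 => le0; apply/colP => i; rewrite mxE.
have sq_ge0 j : true -> 0 <= v j 0 ^+ 2 by rewrite sqr_ge0.
have /eqP : \sum_j v j 0 ^+ 2 = 0 by apply/le_anti; rewrite le0 sumr_ge0.
by rewrite psumr_eq0 // => /allP/(_ i); rewrite mem_index_enum sqrf_eq0 => /(_ isT)/eqP.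
Qed.

Lemma norm2D_orth u w : u^T *m w = 0 ->
  norm2 (u + w) ^+ 2 = norm2 u ^+ 2 + norm2 w ^+ 2.
Proof.
move=> uw; have wu : w^T *m u = 0 by rewrite -[LHS]trmxK trmx_mul trmxK uw trmx0.
rewrite !norm2_sq [(u + w)^T]linearD mulmxDl !mulmxDr uw wu addr0 add0r.
by rewrite [LHS]mxE.
Qed.

Variable A : 'M[R]_n.
Hypothesis symA : A^T = A.

(** By symmetry, [|A y|^2 = y^T A (A y)]. *)
Lemma sym_ker_sq y : A *m (A *m y) = 0 -> A *m y = 0.
Proof.
move=> AAy; apply/eqP; rewrite -norm2_eq0 -sqrf_eq0 norm2_sq.
by rewrite trmx_mul symA -mulmxA AAy mulmx0 mxE.
Qed.

Variables (b : 'cV[R]_n) (S : {vspace 'cV[R]_n}) (x : 'cV[R]_n).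
Hypothesis injA : forall y, y \in S -> A *m y = 0 -> y = 0.
Hypotheses (xS : x \in S) (ker_res : A *m (b - A *m x) = 0).

Let residualB y : b - A *m y = (b - A *m x) + A *m (x - y).
Proof. by rewrite mulmxBr addrA subrK. Qed.

(** The residual at [x] is orthogonal to the range of [A], so by Pythagoras the squared objective at
    [z] exceeds its value at [x] by [|A (x - z)|^2]; on [S] this excess vanishes only at [x], by
    [injA]. *)
Lemma minres_ker_residual y :
  is_argmin S (fun z => norm2 (b - A *m z)) y <-> y = x.
Proof.
have pyth z : norm2 (b - A *m z) ^+ 2 =
    norm2 (b - A *m x) ^+ 2 + norm2 (A *m (x - z)) ^+ 2.
  rewrite [b - A *m z]residualB norm2D_orth //.
  by rewrite mulmxA -[X in _ *m X *m _]symA -trmx_mul ker_res trmx0 mul0mx.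
split=> [[yS ymin]|->].
  apply/esym/subr0_eq/injA; first by rewrite rpredB.
  apply/eqP; rewrite -norm2_eq0 -sqrf_eq0 eq_le sqr_ge0 andbT.
  have := ymin x xS; rewrite -(@ler_pXn2r _ 2) ?nnegrE ?norm2_ge0 //.
  by rewrite pyth gerDl.
split=> // z _; rewrite -(@ler_pXn2r _ 2) ?nnegrE ?norm2_ge0 //.
by rewrite [leRHS]pyth lerDl sqr_ge0.
Qed.

(** The value at [x] is 0, so a minimizer [y] satisfies [A (A (x - y)) = 0]; [sym_ker_sq] and then
    [injA] remove the two factors. *)
Lemma minares_ker_residual y :
  is_argmin S (fun z => norm2 (A *m (b - A *m z))) y <-> y = x.
Proof.
have min0 : norm2 (A *m (b - A *m x)) = 0 by apply/eqP; rewrite norm2_eq0 ker_res.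
split=> [[yS ymin]|->]; last by split=> // z _; rewrite min0 norm2_ge0.
apply/esym/subr0_eq/injA; first by rewrite rpredB.
apply: sym_ker_sq; apply/eqP; rewrite -norm2_eq0 eq_le norm2_ge0 andbT.
by have := ymin x xS; rewrite min0 (residualB y) mulmxDr ker_res add0r.
Qed.

End SymmetricLeastSquares.

Section KrylovPolynomials.
Variables (R : realType) (n : nat) (A : 'M[R]_n.+1) (b : 'cV[R]_n.+1).

(** Reduces questions on Krylov spaces to polynomial arithmetic: size at most [k] is degree below
    [k]. *)
Lemma mem_krylovP k y :
  reflect (exists2 p : {poly R}, (size p <= k)%N & y = horner_mx A p *m b)
          (y \in krylov A b k).
Proof.
apply: (iffP idP) => [|[p szp ->]].
  elim: k y => [|k IHk] y.
    rewrite /krylov /= span_nil memv0 => /eqP->.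
    by exists 0; rewrite ?size_poly0 // rmorph0 mul0mx.
  rewrite /krylov -(addn1 k) iotaD add0n map_cat span_cat /= span_seq1.
  case/memv_addP=> y1 /IHk[p szp ->] [_ /vlineP[c ->] ->].
  exists (p + c *: 'X^k); last first.
    by rewrite rmorphD /= linearZ /= rmorphXn /= horner_mx_X mulmxDl scalemxAl.
  rewrite addn1 (leq_trans (size_polyD _ _)) // geq_max (leq_trans szp) //=.
  by rewrite (leq_trans (size_scale_leq _ _)) // size_polyXn.
rewrite -[p]coefK poly_def rmorph_sum /= mulmx_suml; apply: memv_suml => i _.
rewrite linearZ /= rmorphXn /= horner_mx_X -scalemxAl memvZ // memv_span //.
by apply/map_f; rewrite mem_iota /= add0n (leq_trans _ szp).
Qed.

Lemma dim_krylov_le k : (\dim (krylov A b k) <= k)%N.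
Proof. by rewrite (leq_trans (dim_span _)) // size_map size_iota. Qed.

Lemma krylovS k l : (k <= l)%N -> (krylov A b k <= krylov A b l)%VS.
Proof.
move=> kl; apply/subvP => y /mem_krylovP[p szp ->].
by apply/mem_krylovP; exists p; rewrite ?(leq_trans szp).
Qed.

(** Since [p(A) b = 0], a polynomial [q] may be replaced by its remainder modulo [p]. *)
Lemma krylov_annihilator (p : {poly R}) k : p != 0 -> horner_mx A p *m b = 0 ->
  (krylov A b k <= krylov A b (size p).-1)%VS.
Proof.
move=> p0 pb; apply/subvP => _ /mem_krylovP[q _ ->].
apply/mem_krylovP; exists (q %% p).
  by rewrite -ltnS prednK ?size_poly_gt0 // ltn_modp.
rewrite {1}(divp_eq q p) rmorphD rmorphM /= mulmxDl -mulmxA.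
by rewrite [X in _ *m X + _]pb mulmx0 add0r.
Qed.

(** Without growth, [A ^+ k *m b] is already [q(A) b] with [q] of size at most [k], and ['X^k - q]
    annihilates [b]. *)
Lemma krylov_stagnation k : (\dim (krylov A b k.+1) <= \dim (krylov A b k))%N ->
  exists2 p : {poly R}, size p = k.+1 & horner_mx A p *m b = 0.
Proof.
move=> dimS; have /eqP EK : (krylov A b k == krylov A b k.+1)%VS.
  by rewrite eqEdim krylovS ?leqnSn.
have : A ^+ k *m b \in krylov A b k.
  by rewrite EK memv_span // (map_f (fun i => A ^+ i *m b)) // mem_iota /=.
case/mem_krylovP=> q szq Eq; exists ('X^k - q).
  by rewrite size_polyDl size_polyXn // size_polyN.
by rewrite rmorphB /= rmorphXn /= horner_mx_X mulmxBl Eq subrr.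
Qed.

Variable l : nat.
Hypothesis hl : krylov_max_dim A b l.

(** A nonzero such [p] would confine every Krylov space to dimension below [l], yet [l] is
    attained. *)
Lemma small_annihilator (p : {poly R}) :
  (size p <= l)%N -> horner_mx A p *m b = 0 -> p = 0.
Proof.
move=> szp pb; apply/eqP; apply: contraTT szp => p0.
rewrite -ltnNge; have [[k <-] _] := hl.
rewrite (leq_ltn_trans (dimvS (krylov_annihilator k p0 pb))) //.
by rewrite (leq_ltn_trans (dim_krylov_le _)) // prednK ?size_poly_gt0.
Qed.

(** Stagnation at some [k < l] would give a nonzero annihilator of size [k.+1], at most [l]. *)
Lemma dim_krylov k : (k <= l)%N -> \dim (krylov A b k) = k.
Proof.
elim: k => [|k IHk] kl; first by apply/eqP; rewrite -leqn0 dim_krylov_le.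
apply/eqP; rewrite eqn_leq dim_krylov_le ltnNge.
rewrite -[k in (_ <= k)%N](IHk (ltnW kl)); apply/negP.
case/krylov_stagnation=> p szp pb; move: kl.
by rewrite -szp => /small_annihilator/(_ pb) p0; rewrite p0 size_poly0 in szp.
Qed.

Lemma exists_annihilator :
  exists2 p : {poly R}, size p = l.+1 & horner_mx A p *m b = 0.
Proof. by apply: krylov_stagnation; rewrite (dim_krylov (leqnn l)); case: hl. Qed.

Hypothesis bNrange : ~ exists x, A *m x = b.

(** Makes [l.-1] a true predecessor. For [l = 0] a nonzero constant would annihilate [b], so [b = 0]
    would be in the range. *)
Lemma krylov_max_dim_gt0 : (0 < l)%N.
Proof.
rewrite lt0n; apply/eqP => l0; have [p szp pb] := exists_annihilator.
case: bNrange; exists 0; rewrite mulmx0.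
move: szp pb; rewrite l0 => /eqP/size_poly1P[c c0 ->].
by rewrite horner_mx_C mul_scalar_mx => /eqP; rewrite scaler_eq0 (negPf c0) => /eqP.
Qed.

(** With a constant term [c != 0], the equation [p(A) b = 0] can be solved for [b], as [A] times a
    vector. *)
Lemma annihilator_root0 (p : {poly R}) : horner_mx A p *m b = 0 -> root p 0.
Proof.
move=> pb; have [q [c Ep]] := poly_MXaddC p.
rewrite Ep /root !hornerE; apply: contraT => c0.
case: bNrange; exists (- c^-1 *: (horner_mx A q *m b)).
move: pb; rewrite Ep mulrC rmorphD rmorphM /= horner_mx_X horner_mx_C.
rewrite mulmxDl mul_scalar_mx -mulmxA -scalemxAr => /(canRL (addrK _)) ->.
by rewrite sub0r scaleNr scalerN opprK scalerA mulVf // scale1r.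
Qed.

(** For [y = p(A) b], the polynomial [p * 'X] annihilates [b] and still has size at most [l], so it
    is 0. *)
Lemma krylov_ker0 y : y \in krylov A b l.-1 -> A *m y = 0 -> y = 0.
Proof.
case/mem_krylovP=> p szp -> Ap; suff -> : p = 0 by rewrite rmorph0 mul0mx.
have /small_annihilator : (size (p * 'X)%R <= l)%N.
  rewrite (leq_trans (size_polyMleq _ _)) // size_polyX addn2 /=.
  by rewrite -(prednK krylov_max_dim_gt0).
rewrite mulrC rmorphM /= horner_mx_X -mulmxA => /(_ Ap)/eqP.
by rewrite mulf_eq0 polyX_eq0 => /eqP.
Qed.

Hypothesis symA : A^T = A.

(* An annihilator of b of degree l has the form X q because b is not in the
   range of A, and q(0) != 0 because A and A^2 have the same kernel; so q(A) b
   is, up to scaling, a residual b - A x which A maps to 0. *)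
Lemma exists_ker_residual :
  exists2 x, x \in krylov A b l.-1 & A *m (b - A *m x) = 0.
Proof.
have [p szp pb] := exists_annihilator.
have [q [c Ep]] := poly_MXaddC p.
have c0 : c = 0.
  by have /rootP := annihilator_root0 pb; rewrite Ep !hornerE.
have szq : size q = l.
  move: szp; rewrite Ep size_MXaddC c0 eqxx andbT.
  by case: ifP => // _ [].
have [s [d Eq]] := poly_MXaddC q.
have Aq : A *m (horner_mx A q *m b) = 0.
  by move: pb; rewrite Ep c0 addr0 mulrC rmorphM /= horner_mx_X -mulmxA.
have Eqb : horner_mx A q *m b = A *m (horner_mx A s *m b) + d *: b.
  rewrite Eq mulrC rmorphD rmorphM /= horner_mx_X horner_mx_C.
  by rewrite mulmxDl mul_scalar_mx -mulmxA.
have d0 : d != 0.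
  apply/eqP => d0; rewrite d0 scale0r addr0 in Eqb.
  have /small_annihilator q0 : (size q <= l)%N by rewrite szq.
  have := krylov_max_dim_gt0; rewrite -szq q0 ?size_poly0 //.
  by rewrite Eqb; apply: (sym_ker_sq symA); rewrite -Eqb.
exists (- d^-1 *: (horner_mx A s *m b)).
  rewrite memvZ //; apply/mem_krylovP; exists s => //.
  (* As [d != 0], the size of [q] is one more than that of [s], so [s] has size [l.-1]. *)
  by rewrite -szq Eq size_MXaddC (negPf d0) andbF.
have -> : b - A *m (- d^-1 *: (horner_mx A s *m b)) =
          d^-1 *: (horner_mx A q *m b).
  by rewrite Eqb -scalemxAr scaleNr opprK scalerDr scalerA mulVf // scale1r addrC.
by rewrite -scalemxAr Aq scaler0.
Qed.

End KrylovPolynomials.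

Theorem theorem8 (R : realType) (n : nat) (A : 'M[R]_n) (b : 'cV[R]_n)
    (l : nat) (hl : krylov_max_dim A b l) (hA : A^T = A)
    (hb : ~ exists x : 'cV[R]_n, A *m x = b) :
  [/\ exists! xA, is_minares_iterate A b l.-1 xA,
      exists! x, is_minres_iterate A b l.-1 x &
      forall xA x, is_minares_iterate A b l.-1 xA ->
        is_minres_iterate A b l.-1 x -> xA = x].
Proof.
case: n A b hl hA hb => [|n] A b hl hA hb.
  (* The polynomial lemmas need a positive matrix size; in dimension 0, [b = 0 = A 0] contradicts
     [hb]. *)
  by case: hb; exists 0; rewrite [RHS]flatmx0 [LHS]flatmx0.
have [x xS rx] := exists_ker_residual hl hb hA.
have inj := krylov_ker0 hl hb.
have minres y := minres_ker_residual hA inj xS rx y.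
have minares y := minares_ker_residual hA inj xS rx y.
split=> [||y z /minares -> /minres -> //].
- by exists x; split=> [|y /minares]; [apply/minares|].
- by exists x; split=> [|y /minres]; [apply/minres|].
Qed.
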